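(* Let $X$ be a quasiregular space and let $\kappa=L(X)\cdot wt(X)$. If a cardinal $\lambda$ satisfying $\kappa<\lambda\leq\left(2^{\kappa}\right)^+$ is a caliber of $X$, then $d(X)\leq 2^{\kappa}$.
   Context: A space $X$ is quasiregular if for every non-empty open set $U$ there is a non-empty open set $V$ such that $\overline{V}\subseteq U$. A cardinal $\lambda$ is a caliber of $X$ if every family of open sets of $X$ of cardinality $\lambda$ has a subfamily of cardinality $\lambda$ with non-empty intersection. The tightness $t(Y)$ of a space $Y$ is the least infinite cardinal $\kappa$ such that whenever $A\subseteq Y$ and $x\in\overline{A}$ there is $B\subseteq A$ with $|B|\leq\kappa$ and $x\in\overline{B}$. For a cardinal $\mu$ and $A\subseteq X$, the $\mu$-closure of $A$ is $cl_\mu A=\bigcup\{\overline{B}:B\subseteq A,\ |B|\leq\mu\}$. The weak tightness $wt(X)$ is the least infinite cardinal $\kappa$ for which there is a cover $\mathcal{C}$ of $X$ by subsets of $X$ such that $|\mathcal{C}|\leq 2^\kappa$ and for all $C\in\mathcal{C}$: (a) $t(C)\leq\kappa$ (subspace topology) and (b) $X=cl_{2^\kappa}C$. $L(X)$ is the Lindelöf degree (the least infinite cardinal $\mu$ such that every open cover of $X$ has a subcover of size at most $\mu$), and $d(X)$ is the density of $X$ (the least cardinality of a dense subset). *)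

(* Defs.v *)
From mathcomp Require Import all_boot.
From mathcomp Require Import all_classical topology.

Set Implicit Arguments.
Unset Strict Implicit.
Unset Printing Implicit Defensive.

Local Open Scope classical_set_scope.
Local Open Scope card_scope.

(* A cardinal is represented by a type K, considered up to equipotence: "A has
   cardinality K" is A #= [set: K], 2^K is the power type (set K), and the
   product of K and L is the type K * L. *)

Definition card_lt (K L : Type) : Prop :=
  [set: K] #<= [set: L] /\ ~ ([set: L] #<= [set: K]).

Definition is_least_card (P : Type -> Prop) (K : Type) : Prop :=
  P K /\ forall L : Type, P L -> [set: K] #<= [set: L].

(* The least cardinal satisfying P, with the dummy value False when no cardinal
   satisfies P; see least_cardP. *)
Definition least_card (P : Type -> Prop) : Type :=
  if pselect (exists K, is_least_card P K) is left e then projT1 (cid e)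
  else False.

Lemma card_family_min (I : Type) (F : I -> Type) : inhabited I ->
  exists i, forall j, [set: F i] #<= [set: F j].
Proof.
case=> i0; pose sep (M : set (forall i, F i)) :=
  forall f g, M f -> M g -> forall i, f i = g i -> f = g.
have [|M [sepM maxM]] := @Zorn_bigcup _ sep.
  move=> G Gsep Gtot f g [A GA Af] [B GB Bg] i.
  by case: (Gtot A B GA GB) => AB; [apply: (Gsep B GB) => //; exact: AB|
     apply: (Gsep A GA) => //; exact: AB].
have [[i Mi]|nM] := pselect (exists i, forall x : F i, exists f, M f /\ f i = x).
  exists i => j; pose h x := projT1 (cid (Mi x)).
  have hP x : M (h x) /\ h x i = x by rewrite /h; case: cid.
  have hinj : injective (fun x => h x j).
    move=> x y hxy; have [Mx <-] := hP x; have [My <-] := hP y.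
    by rewrite (sepM _ _ Mx My j hxy).
  apply: (card_le_trans _ (card_leT [set h x j | x in [set: F i]])).
  have /card_eqPle[//] : [set h x j | x in [set: F i]] #= [set: F i].
  by apply: inj_card_eq => x y _ _; exact: hinj.
have new i : exists x : F i, forall f, M f -> f i <> x.
  apply: contrapT => /forallNP nx; apply: nM; exists i => x.
  apply: contrapT => nf; apply: (nx x) => f Mf fx.
  by apply: nf; exists f.
pose g i := projT1 (cid (new i)).
have gP i f : M f -> f i <> g i by rewrite /g; case: cid => x + Mf; exact.
case: (maxM (M `|` [set g])).
  split; first by move=> f Mf; left.
  by move=> /(_ g (or_intror erefl)) Mg; exact: (gP i0 g Mg).
move=> f f' [Mf|->] [Mf'|->] i ff' //.
- exact: sepM Mf Mf' i ff'.
- by case: (gP i f Mf).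
- by case: (gP i f' Mf').
Qed.

Lemma card_le_total (K L : Type) :
  [set: K] #<= [set: L] \/ [set: L] #<= [set: K].
Proof.
have [|[] h] := @card_family_min bool (fun b => if b then K else L).
- exact: (inhabits true).
- by left; exact: (h false).
- by right; exact: (h true).
Qed.

(* The minimum is taken over the subsets of a fixed K0 and not over all types:
   the latter would put the universe of cardinals below that of topologicalType. *)
Lemma least_cardP (P : Type -> Prop) :
  (exists K, P K) -> is_least_card P (least_card P).
Proof.
move=> [K0 PK0]; rewrite /least_card; case: pselect => [e|]; first by case: cid.
case; pose J := {S : set K0 | exists K, P K /\ [set: K] #= S}.
have J0 : inhabited J by constructor; exists setT, K0.
have [i Smin] := @card_family_min J (fun i => set_type (sval i)) J0.
have [K [PK KS]] := svalP i; exists K; split=> // L PL.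
have KK0 : [set: K] #<= [set: K0].
  by rewrite (card_le_eql KS); exact: card_leT.
have [LK0|K0L] := card_le_total L K0; last exact: card_le_trans KK0 K0L.
have [S LS] : exists S : set K0, [set: L] #= S.
  have /card_leP[f] := LK0.
  pose h (x : L) := sval (f (SigSub (mem_set (I : [set: L] x)))).
  exists (h @` setT); rewrite card_eq_sym; apply: inj_card_eq => x y _ _ hxy.
  suff [] : SigSub (mem_set (I : [set: L] x)) = SigSub (mem_set (I : [set: L] y)) by [].
  by apply: (@inj _ _ _ f); rewrite ?inE //; exact: val_inj.
have := Smin (exist _ S (ex_intro _ L (conj PL LS))).
by rewrite /= (card_le_eql (card_setT _)) (card_le_eqr (card_setT _)) -(card_le_eql KS) -(card_le_eqr LS).
Qed.

Definition card_succ (K : Type) : Type := least_card (card_lt K).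

Definition infinite_card (K : Type) : Prop := infinite_set [set: K].

Definition quasiregular (X : topologicalType) : Prop :=
  forall U : set X, open U -> U !=set0 ->
  exists V : set X, [/\ open V, V !=set0 & closure V `<=` U].

(* The families are sets of open sets, not indexed families; for infinite K it
   is immaterial whether the empty set may belong to F. *)
Definition caliber (X : topologicalType) (K : Type) : Prop :=
  forall F : set (set X), (forall U, F U -> open U) -> F #= [set: K] ->
  exists G : set (set X),
    [/\ G `<=` F, G #= [set: K] & \bigcap_(U in G) U !=set0].

Definition tightness (Y : topologicalType) : Type :=
  least_card (fun K => infinite_card K /\
    forall (A : set Y) (x : Y), closure A x ->
    exists B : set Y, [/\ B `<=` A, B #<= [set: K] & closure B x]).

Definition mu_closure (X : topologicalType) (M : Type) (A : set X) : set X :=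
  \bigcup_(B in [set B : set X | B `<=` A /\ B #<= [set: M]]) closure B.

(* set_type C carries the topology induced by X. *)
Definition weak_tightness (X : topologicalType) : Type :=
  least_card (fun K => infinite_card K /\
    exists CC : set (set X),
      [/\ \bigcup_(C in CC) C = [set: X],
          CC #<= [set: set K] &
          forall C, CC C ->
            [set: tightness (set_type C)] #<= [set: K] /\
            mu_closure (set K) C = [set: X]]).

Definition lindelof_degree (X : topologicalType) : Type :=
  least_card (fun K => infinite_card K /\
    forall UU : set (set X),
      (forall U, UU U -> open U) -> \bigcup_(U in UU) U = [set: X] ->
    exists VV : set (set X),
      [/\ VV `<=` UU, VV #<= [set: K] & \bigcup_(V in VV) V = [set: X]]).

Definition density (X : topologicalType) : Type :=
  least_card (fun K => exists D : set X, dense D /\ D #= [set: K]).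

(* Main.v *)
Require Import Defs.
From mathcomp Require Import all_boot.
From mathcomp Require Import all_classical topology wochoice.

(* Let K = L(X) wt(X) and suppose that no set of size at most 2^K is dense.
   Recursively along lambda choose increasing sets A_a of size at most 2^K and,
   by quasiregularity, nonempty open V_a whose closure is disjoint from that of
   A_a. The set A_a is taken so large that it meets every nonempty intersection
   of at most K of the closures of the V_b, b < a, and that A_b is contained in
   the closure of A_a `&` C for all b < a and all C in the cover witnessing
   wt(X). As lambda is a caliber, lambda many V_a share a point; keep the first
   K^+ of these indices, a set J in which every K-sequence is bounded. Let D be
   the union of the A_a, a in J. By choice of the A_a, any K of the closures of
   the V_a have a common point in D, so by L(X) <= K all of them have a common
   point q in the closure of D. If q lies in the member C of the cover, then q
   is in the closure of D `&` C, hence, by tightness of C, in that of a subset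
   of size K, hence in the closure of a single A_a: a contradiction with
   q being in the closure of V_a. *)

Local Open Scope classical_set_scope.
Local Open Scope card_scope.

(** * Comparing cardinals by functions between types *)

(** As [f] is total on [T], a point of [B] must supply its values off [A]. *)
Lemma card_le_injP {T U} {A : set T} {B : set U} : B !=set0 ->
  A #<= B <-> exists f : T -> U, (forall x, A x -> B (f x)) /\
    (forall x y, A x -> A y -> f x = f y -> x = y).
Proof.
move=> [b0 Bb0]; split=> [|[f [fB finj]]]; last first.
  have fA : f @` A #= A.
    by apply: inj_card_eq => x y; rewrite !inE; exact: finj.
  rewrite -(card_le_eql fA); apply: subset_card_le => _ [x Ax <-].
  exact: fB.
move=> /card_leP[F].
exists (fun x => if pselect (A x) is left Ax then \val (F (SigSub (mem_set Ax)))
                 else b0).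
split=> [x Ax|x y Ax Ay].
  by case: pselect => // Ax'; exact/set_mem/valP.
case: pselect => // Ax'; case: pselect => // Ay' /val_inj /(@inj _ _ _ F).
by rewrite !inE => /(_ I I) [].
Qed.

Lemma inj_card_leT {K L : Type} (f : K -> L) :
  injective f -> [set: K] #<= [set: L].
Proof.
move=> finj; rewrite -(card_le_eql (inj_card_eq (in2W finj))).
exact: card_leT.
Qed.

Lemma card_le_range_in {T} {K : Type} {A : set T} : A !=set0 ->
  A #<= [set: K] -> exists2 g : K -> T, (forall k, A (g k)) & A `<=` range g.
Proof.
move=> [x0 Ax0] /pfcard_geP[A0|[g]]; first by rewrite A0 in Ax0.
exists g => [k|x Ax]; first exact: (@funS _ _ _ _ g).
by have [k _ <-] := @surj _ _ _ _ g x Ax; exists k.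
Qed.

Lemma card_le_range {T} {K : Type} {A : set T} (x0 : T) :
  A #<= [set: K] -> exists g : K -> T, A `<=` range g.
Proof.
move=> AK; have [A0|A0] := pselect (A !=set0).
  by have [g _ gA] := card_le_range_in A0 AK; exists g.
by exists (fun=> x0) => x Ax; case: A0; exists x.
Qed.

Lemma range_card_le {T} {K : Type} {A : set T} (g : K -> T) :
  A `<=` range g -> A #<= [set: K].
Proof.
move=> /subset_card_le Ag; exact: (card_le_trans Ag (card_image_le _ _)).
Qed.

Lemma card_le_setT_set {K L : Type} :
  [set: K] #<= [set: L] -> [set: set K] #<= [set: set L].
Proof.
move=> KL; have [[k0 _]|K0] := pselect ([set: K] !=set0).
  have [g gK] := card_le_range k0 KL.
  apply: (@inj_card_leT _ _ (fun A => g @^-1` A)); apply: (can_inj (g := image^~ g)).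
  by move=> A; apply: image_preimage; rewrite -subTset.
apply: (@inj_card_leT _ _ (fun=> set0)) => A B _; apply/seteqP.
by split=> k; case: K0; exists k.
Qed.

Lemma card_le_set_total {T U} (A : set T) (B : set U) : A #<= B \/ B #<= A.
Proof.
have [AB|AB] := card_le_total A B; [left|right].
  by rewrite -(card_le_eql (card_setT _)) -(card_le_eqr (card_setT _)).
by rewrite -(card_le_eql (card_setT _)) -(card_le_eqr (card_setT _)).
Qed.

Lemma infinite_inj_nat {T} {A : set T} : infinite_set A ->
  exists2 i : nat -> T, (forall n, A (i n)) & injective i.
Proof.
move=> Ainf; have A0 := infinite_setN0 Ainf.
have /infiniteP/(card_le_injP A0)[i [iA iinj]] := Ainf.
by exists i => [n|m n]; [exact: iA|exact: iinj].
Qed.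

(** * The square of an infinite cardinal *)

Section square.
Context {K : Type}.
Implicit Types G : set (K * K * K).

Let S G : set K := [set x | exists z, G (x, x, z)].

(* G is the graph of a (multivalued) injection of S G * S G into S G. *)
Let square_graph G := [/\ forall x y z, G (x, y, z) -> [/\ S G x, S G y & S G z],
  forall x y, S G x -> S G y -> exists z, G (x, y, z),
  forall x y x' y' z, G (x, y, z) -> G (x', y', z) -> x = x' /\ y = y' &
  G = set0 \/ infinite_set (S G)].

Let square_graph_bigcup (F : set (set (K * K * K))) :
  F `<=` square_graph -> total_on F subset ->
  square_graph (\bigcup_(G in F) G).
Proof.
move=> Fsq Ftot.
have SF G : F G -> S G `<=` S (\bigcup_(G in F) G).
  by move=> FG x [z Gz]; exists z; exists G.
split.
- move=> x y z [G FG Gxyz]; have [/(_ _ _ _ Gxyz)[Sx Sy Sz] _ _ _] := Fsq _ FG.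
  by split; exact: (SF _ FG).
- move=> x y [z [G FG Gx]] [t [H FH Hy]].
  have [GH|HG] := Ftot _ _ FG FH.
    have Sx : S H x by exists z; exact: GH.
    have Sy : S H y by exists t.
    have [_ /(_ _ _ Sx Sy)[u Hu] _ _] := Fsq _ FH.
    by exists u; exists H.
  have Sx : S G x by exists z.
  have Sy : S G y by exists t; exact: HG.
  have [_ /(_ _ _ Sx Sy)[u Gu] _ _] := Fsq _ FG.
  by exists u; exists G.
- move=> x y x' y' z [G FG Gx] [H FH Hy].
  have [GH|HG] := Ftot _ _ FG FH.
    by have [_ _ inj _] := Fsq _ FH; apply: inj Hy; exact: GH.
  by have [_ _ inj _] := Fsq _ FG; apply: inj Gx _; exact: HG.
- have [[G [FG G0]]|nG] := pselect (exists G, F G /\ G !=set0); [right|left].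
    have [_ _ _ [GE|]] := Fsq _ FG; last exact/sub_infinite_set/SF.
    by move: G0; rewrite GE => -[].
  by rewrite -subset0 => t [G FG Gt]; apply: nG; exists G; split=> //; exists t.
Qed.

(** Take a maximal graph [G]. If the complement of [S G] embeds in [S G], then so does [K], and [G]
    injects the square; otherwise [S G] has a disjoint copy in its complement, into which [G] could
    be extended. *)
Lemma card_square : infinite_set [set: K] -> [set: K * K] #<= [set: K].
Proof.
move=> Kinf; have [i _ iinj] := infinite_inj_nat Kinf.
have [G [[GS Gtot Ginj Ginf] Gmax]] := Zorn_bigcup square_graph_bigcup.
have {}Ginf : infinite_set (S G).
  case: Ginf => // G0; exfalso.
  pose H : set (K * K * K) :=
    [set p | exists m n, p = (i m, i n, i (pickle (m, n)))].
  apply: (Gmax H).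
    rewrite G0; split; first by move=> p.
    by move=> /(_ (i 0, i 0, i (pickle (0, 0)))); apply; exists 0, 0.
  have SH n : S H (i n) by exists (i (pickle (n, n))), n, n.
  split.
  - by move=> _ _ _ [m [n [-> -> ->]]]; split; exact: SH.
  - move=> _ _ [_ [m [_ [-> _ _]]]] [_ [n [_ [-> _ _]]]].
    by exists (i (pickle (m, n))), m, n.
  - move=> _ _ _ _ _ [m [n [-> -> ->]]] [m' [n' [-> -> /iinj]]].
    by move=> /(pcan_inj pickleK)[-> ->].
  - right; apply/infiniteP/card_le_injP; first by exists (i 0).
    by exists i; split=> // m n _ _ /iinj.
have [j jS jinj] := infinite_inj_nat Ginf.
have /choice[f fG] : forall p : K * K, exists z,
    S G p.1 -> S G p.2 -> G (p.1, p.2, z).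
  move=> [x y]; have [[Sx Sy]|nS] := pselect (S G x /\ S G y).
    by have [z Gz] := Gtot x y Sx Sy; exists z.
  by exists x => /= Sx Sy; case: nS.
have {}fG x y : S G x -> S G y -> G (x, y, f (x, y)) by exact: (fG (x, y)).
have fS x y : S G x -> S G y -> S G (f (x, y)).
  by move=> Sx Sy; have [] := GS _ _ _ (fG _ _ Sx Sy).
have finj x y x' y' : S G x -> S G y -> S G x' -> S G y' ->
    f (x, y) = f (x', y') -> x = x' /\ y = y'.
  move=> Sx Sy Sx' Sy' ff; apply: Ginj (fG _ _ Sx' Sy').
  by rewrite -ff; exact: fG.
have [|/card_le_injP] := card_le_set_total (~` S G) (S G).
  have SN0 : S G !=set0 by exists (j 0).
  move=> /(card_le_injP SN0)[h [hS hinj]].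
  (* As [j 0] and [j 1] differ, the two branches have disjoint ranges, so [K] embeds in [S G]. *)
  pose m k := if pselect (S G k) then f (j 0, k) else f (j 1, h k).
  have mS k : S G (m k) by rewrite /m; case: pselect => Sk; apply: (fS) => //; exact: hS.
  have minj : injective m.
    move=> k l; rewrite /m; case: pselect => Sk; case: pselect => Sl /finj[] //.
    - exact: hS.
    - by move=> /jinj.
    - exact: hS.
    - by move=> /jinj.
    - exact: hS.
    - exact: hS.
    - by move=> _; exact: hinj.
  apply: (@inj_card_leT _ _ (fun p => f (m p.1, m p.2))).
  by move=> [x y] [x' y'] /= /finj[||||/minj-> /minj->].
have [nS0|nS0] := pselect ((~` S G) !=set0); last first.
  have ST x : S G x by apply: contrapT => nSx; apply: nS0; exists x.
  move=> _; apply: (@inj_card_leT _ _ f).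
  by move=> [x y] [x' y'] /finj[//|//|//|//|-> ->].
move=> /(_ nS0)[h [hS hinj]]; exfalso.
(* G is not maximal: extend it to the square of the union of S G and its disjoint
   copy h @` S G, sending the three new blocks into the copy; f (j n, _), n < 4,
   has disjoint ranges for distinct n. *)
pose e (p : bool) x := if p then h x else x.
pose c (p q : bool) x y := h (f (j (p.*2 + q), f (x, y))).
have cN p q x y : S G x -> S G y -> ~ S G (c p q x y).
  by move=> Sx Sy; apply: hS; apply: (fS) => //; exact: fS.
have cinj p q x y p' q' x' y' : S G x -> S G y -> S G x' -> S G y' ->
    c p q x y = c p' q' x' y' -> [/\ p = p', q = q', x = x' & y = y'].
  move=> Sx Sy Sx' Sy' cE; have F := fS _ _ Sx Sy; have F' := fS _ _ Sx' Sy'.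
  have ffE := hinj _ _ (fS _ _ (jS _) F) (fS _ _ (jS _) F') cE.
  have [/jinj pq fE] := finj _ _ _ _ (jS _) F (jS _) F' ffE.
  have [-> ->] := finj _ _ _ _ Sx Sy Sx' Sy' fE.
  by move: pq {cE ffE}; case: p q p' q' => [] [] [] [].
pose H : set (K * K * K) := [set t | G t \/ exists p q x y,
  [/\ p || q, S G x, S G y & t = (e p x, e q y, c p q x y)]].
have SH p x : S G x -> S H (e p x).
  case: p => /= Sx.
    by exists (c true true x x); right; exists true, true, x, x.
  by exists (f (x, x)); left; exact: fG.
have HS x : S H x -> exists p y, S G y /\ x = e p y.
  move=> [z [Gz|[p [q [y [y' [_ Sy _ [xp _ _]]]]]]]]; last by exists p, y.
  by exists false, x; split=> //; exists z.
apply: (Gmax H).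
  split; first by move=> t Gt; left.
  move=> HG.
  have /HG/GS[+ _ _] : H (e true (j 0), e true (j 0), c true true (j 0) (j 0)).
    by right; exists true, true, (j 0), (j 0).
  exact: hS.
split.
- move=> x y z [/GS[Sx Sy Sz]|[p [q [x' [y' [_ Sx' Sy' [-> -> ->]]]]]]].
    by split; [exact: (SH false)|exact: (SH false)|exact: (SH false)].
  split; [exact: SH|exact: SH|].
  by apply: (SH true); apply: (fS) => //; exact: fS.
- move=> _ _ /HS[p [x [Sx ->]]] /HS[q [y [Sy ->]]].
  case pq : (p || q).
    by exists (c p q x y); right; exists p, q, x, y.
  move: pq; case: p q => [] [] //= _.
  by exists (f (x, y)); left; exact: fG.
- move=> x y x' y' z [Gz|[p [q [u [v [pq Su Sv [-> -> ->]]]]]]].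
    move=> [|[p' [q' [u' [v' [pq' Su' Sv' [-> -> zE]]]]]]]; first exact: Ginj.
    have [_ _ Sz] := GS _ _ _ Gz.
    by rewrite zE in Sz; case: (cN p' q' _ _ Su' Sv').
  move=> [|[p' [q' [u' [v' [pq' Su' Sv' [-> -> /cinj[//|//|//|//|]]]]]]]].
    by move=> /GS[_ _ /(cN _ _ _ _ Su Sv)].
  by move=> -> -> -> ->.
- right; apply: sub_infinite_set Ginf => x Sx; exact: (SH false).
Qed.

End square.

(** * Unions of few small sets *)

Lemma card_le_bigcup {I T : Type} {K : Type} {D : set I} {F : I -> set T} :
  infinite_set [set: K] -> D #<= [set: K] ->
  (forall i, D i -> F i #<= [set: K]) ->
  \bigcup_(i in D) F i #<= [set: K].
Proof.
move=> Kinf DK FK; apply: (card_le_trans _ (card_square Kinf)).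
have [[x0 [i0 Di0 Fx0]]|F0] := pselect ((\bigcup_(i in D) F i) !=set0); last first.
  suff -> : \bigcup_(i in D) F i = set0 by exact: card_ge0.
  by rewrite -subset0 => x Fx; apply: F0; exists x.
have [d Dd dD] := card_le_range_in (ex_intro _ i0 Di0) DK.
have /choice[h hF] : forall k, exists g : K -> T, F (d k) `<=` range g.
  by move=> k; exact: (card_le_range x0 (FK _ (Dd k))).
apply: (@range_card_le _ _ _ (fun p => h p.1 p.2)) => x [i Di Fx].
have [k _ ki] := dD _ Di; rewrite -ki in Fx; have [l _ <-] := hF _ _ Fx.
by exists (k, l).
Qed.

Lemma card_le_setU {T K : Type} {A B : set T} : infinite_set [set: K] ->
  A #<= [set: K] -> B #<= [set: K] -> A `|` B #<= [set: K].
Proof.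
move=> Kinf AK BK; have [i _ iinj] := infinite_inj_nat Kinf.
have bK : [set: bool] #<= [set: K].
  by apply: (@inj_card_leT _ _ (fun b : bool => i b)) => -[] [] // /iinj.
have -> : A `|` B = \bigcup_(b in [set: bool]) (if b then A else B).
  apply/seteqP; split=> [x [Ax|Bx]|x [[] _ ?]]; [|by exists false|by left|by right].
  by exists true.
by apply: (card_le_bigcup Kinf bK) => -[].
Qed.

(** * Well-orders, initial segments and recursion *)

Lemma exists_strict_well_order (T : Type) : exists lt : T -> T -> Prop,
  well_founded lt /\ forall x y, [\/ lt x y, x = y | lt y x].
Proof.
have [R Rwo] := well_ordering_principle {classic T}.
exists (fun x y => ~~ R y x); split=> [|x y].
  move=> a; apply: contrapT => na.
  have [|z [[/asboolP nz zmin] _]] := Rwo [pred x | `[< ~ Acc (fun x y => ~~ R y x) x >]].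
    by exists a; apply/asboolP.
  apply: nz; constructor=> y; apply: contraNP => ny; apply: zmin.
  exact/asboolP.
have /wo_chain_antisymmetric Ranti : wo_chain R predT by exact: withinW.
case: (boolP (R y x)) => [Ryx|]; last by constructor 1.
case: (boolP (R x y)) => [Rxy|]; last by constructor 3.
by constructor 2; apply: (Ranti x y) => //; rewrite Rxy.
Qed.

Section well_founded.
Context {T : Type} {lt : T -> T -> Prop}.
Hypothesis wf : well_founded lt.

Lemma wf_minimal {A : set T} : A !=set0 ->
  exists2 a, A a & forall b, lt b a -> ~ A b.
Proof.
move=> [a Aa]; elim/(well_founded_ind wf): a Aa => a IH Aa.
have [[b [ba Ab]]|nb] := pselect (exists b, lt b a /\ A b); first exact: (IH b).
by exists a => // b ba Ab; apply: nb; exists b.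
Qed.

(** Cut [I] at its least element below which [P] already holds. This replaces initial ordinals: with
    [P] a lower bound on size, all proper initial segments of [J] are too small. *)
Lemma minimal_segment (P : set T -> Prop) (I : set T) :
  (forall A B, A `<=` B -> P A -> P B) -> P I ->
  exists J, [/\ J `<=` I, P J & forall a, J a -> ~ P (J `&` [set b | lt b a])].
Proof.
move=> Pmono PI.
have [e|ne] := pselect (([set a | I a /\ P (I `&` [set b | lt b a])]) !=set0).
  have [a [Ia Pa] amin] := wf_minimal e.
  exists (I `&` [set b | lt b a]); split=> [b []//|//|b [Ib ba] Pb].
  by apply: (amin _ ba); split=> //; apply: Pmono Pb => c [[]].
by exists I; split=> // a Ia Pa; apply: ne; exists a.
Qed.

(** The step [H] sees only the set of earlier values with index in [W], which is all that the
    construction of the [A a] uses. *)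
Lemma wf_recursion (U : Type) (W : set T) (H : set U -> U) :
  exists A : T -> U, forall a, A a = H [set A b | b in W `&` [set b | lt b a]].
Proof.
pose F a (rec : forall b, lt b a -> U) :=
  H [set u | exists b (ba : lt b a), W b /\ rec b ba = u].
exists (Fix wf (fun=> U) F) => a; rewrite Fix_eq; last first.
  by move=> x f g fg; congr H; apply/seteqP; split=> u [b [bx [Wb <-]]];
    exists b, bx; rewrite fg.
congr H; apply/seteqP; split=> u.
  by move=> [b [ba [Wb <-]]]; exists b.
by move=> [b [Wb ba] <-]; exists b, ba.
Qed.

End well_founded.

(** * The recursive construction and the contradiction *)

Section caliber_density.
Context {X : topologicalType} {K lambda : Type} {CC : set (set X)}.
Hypothesis Kinf : infinite_card K.
Hypothesis lindelof : forall UU : set (set X),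
  (forall U, UU U -> open U) -> \bigcup_(U in UU) U = [set: X] ->
  exists VV : set (set X),
    [/\ VV `<=` UU, VV #<= [set: K] & \bigcup_(V in VV) V = [set: X]].
Hypothesis CC_cover : \bigcup_(C in CC) C = [set: X].
Hypothesis CC_card : CC #<= [set: set K].
Hypothesis CC_tight : forall C A x, CC C -> A `<=` C -> C x -> closure A x ->
  exists B, [/\ B `<=` A, B #<= [set: K] & closure B x].
Hypothesis CC_dense : forall C, CC C -> mu_closure (set K) C = [set: X].
Hypothesis quasiregX : quasiregular X.
Hypothesis K_lambda : ~ ([set: lambda] #<= [set: K]).
(** The bound of lambda by the successor of 2^K, with the successor eliminated. *)
Hypothesis lambda_le : forall L : Type,
  ~ ([set: L] #<= [set: set K]) -> [set: lambda] #<= [set: L].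
Hypothesis calX : caliber X lambda.

Let K_inh : inhabited K.
Proof. by have [k _] := infinite_setN0 Kinf; constructor. Qed.

Let K_setK : [set: K] #<= [set: set K].
Proof.
apply: (@inj_card_leT _ _ (fun k => [set k])) => k l kl.
by have : [set k] l by rewrite kl.
Qed.

Let setK_inf : infinite_set [set: set K].
Proof.
by apply/infiniteP; apply: card_le_trans K_setK; exact/infiniteP.
Qed.

Lemma caliber_density : exists D : set X, dense D /\ D #<= [set: set K].
Proof.
apply: contrapT => nD.
have ndense (A : set X) : A #<= [set: set K] -> ~ dense A.
  by move=> Asmall Adense; apply: nD; exists A.
have [x0] : inhabited X.
  have /existsNP[O] := ndense set0 (card_ge0 _ _).
  by move=> /not_implyP[[x _] _].
(* Some nonempty open [O] misses a nondense [A]; quasiregularity shrinks it to [V] with closure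
   inside [O], hence off the closure of [A]. *)
have /choice[v vP] : forall A : set X, exists V : set X, ~ dense A ->
    [/\ open V, V !=set0 & forall z, closure V z -> ~ closure A z].
  move=> A; have [dA|] := pselect (dense A); first by exists set0.
  move=> /existsNP[O] /not_implyP[O0] /not_implyP[Oop OA].
  have [V [Vop V0 VO]] := quasiregX _ Oop O0.
  exists V => _; split=> // z /VO Oz /(_ O)[]; first exact: open_nbhs_nbhs.
  by move=> y [Ay Oy]; apply: OA; exists y.
have /choice[s sP] : forall p : X * set X, exists B : set X, CC p.2 ->
    [/\ B `<=` p.2, B #<= [set: set K] & closure B p.1].
  move=> [x C]; have [CCC|] := pselect (CC C); last by exists set0.
  have : mu_closure (set K) C x by rewrite CC_dense.
  by move=> [B [BC BK] Bx]; exists B.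
(* Once [sat (A a)] is contained in [A b] for all a < b, the union of the [A a]
   along a limit meets every C in CC in a dense subset; [wit] provides points
   common to at most K of the sets [closure (V b)], b < a. *)
pose sat A : set X := \bigcup_(x in A) \bigcup_(C in CC) s (x, C).
pose wit (F : set (set X)) : set X :=
  [set xget x0 (\bigcap_(k in [set: K]) g k) | g in [set g | forall k, F (g k)]].
pose H Fam := \bigcup_(A in Fam) (A `|` sat A) `|` wit [set closure (v A) | A in Fam].
have sat_small A : A #<= [set: set K] -> sat A #<= [set: set K].
  move=> AK; apply: (card_le_bigcup setK_inf AK) => x Ax.
  by apply: (card_le_bigcup setK_inf CC_card) => C /(sP (x, C))[].
(* There are at most (2^K)^K = 2^(K*K) sequences in [F]: with [F] enumerated by [e] on [set K], a
   relation on [K] codes a sequence of codes. *)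
have wit_small F : F #<= [set: set K] -> wit F #<= [set: set K].
  move=> FK; apply: (card_le_trans _ (card_le_setT_set (card_square Kinf))).
  have [e eF] := card_le_range set0 FK.
  apply: (range_card_le (fun r : set (K * K) =>
    xget x0 (\bigcap_(k in [set: K]) e [set j | r (k, j)]))).
  move=> _ [g gF <-].
  have /choice[h hg] : forall k, exists A, e A = g k.
    by move=> k; have [A _ <-] := eF _ (gF k); exists A.
  exists [set p | h p.1 p.2] => //; congr (xget x0 _).
  by apply: eq_bigcapr => k _; rewrite -hg.
have [lt [wf tri]] := exists_strict_well_order lambda.
(* lambda need not be an initial ordinal for lt, but W is. *)
have [W [_ lamW Wseg]] := minimal_segment wf
  (fun A : set lambda => [set: lambda] #<= A) setT
  (fun A B AB lamA => card_le_trans lamA (subset_card_le AB)) (card_lexx _).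
have [A AE] := wf_recursion wf _ W H.
(* Lambda does not embed in a proper segment of [W], so by [lambda_le] the segment has size at most
   2^K. *)
have seg_small a : W a -> W `&` [set b | lt b a] #<= [set: set K].
  move=> /Wseg; apply: contra_notP => nsmall.
  rewrite -(card_le_eqr (card_setT _)); apply: lambda_le.
  by rewrite (card_le_eql (card_setT _)).
have A_small a : W a -> A a #<= [set: set K].
  elim/(well_founded_ind wf): a => a IH Wa; rewrite AE; apply: (card_le_setU setK_inf).
    rewrite bigcup_image; apply: (card_le_bigcup setK_inf (seg_small _ Wa)).
    by move=> b [Wb ba]; apply: (card_le_setU setK_inf); [|apply: sat_small]; exact: IH.
  apply: wit_small; rewrite image_comp.
  exact: card_le_trans (card_image_le _ _) (seg_small _ Wa).
have A_sub a b : W a -> lt a b -> A a `|` sat (A a) `<=` A b.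
  by move=> Wa ab x Ax; rewrite (AE b); left; exists (A a) => //; exists a.
pose V a := v (A a).
have VP a : W a -> [/\ open (V a), V a !=set0 &
    forall z, closure (V a) z -> ~ closure (A a) z].
  by move=> Wa; exact/vP/ndense/A_small.
(* The common point [p] makes the intersection nonempty, so that [xget] returns a member and not the
   default [x0]. *)
have wit_mem b (g : K -> lambda) p : W b -> (forall k, W (g k) /\ lt (g k) b) ->
    (forall k, V (g k) p) -> exists2 z, A b z & forall k, closure (V (g k)) z.
  move=> Wb gb gp; exists (xget x0 (\bigcap_(k in [set: K]) closure (V (g k)))).
    rewrite AE; right; exists (fun k => closure (V (g k))) => // k.
    by exists (A (g k)) => //; exists (g k); [split; case: (gb k)|].
  have : (\bigcap_(k in [set: K]) closure (V (g k))) p.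
    by move=> k _; exact/subset_closure/gp.
  by move=> /(xgetI x0) zP k; exact: zP.
(* Calibers concern sets of open sets, so the [V a] must be distinct. The constant sequence [a]
   yields a point of [A b] in the closure of [V a], whereas the closure of [V b] misses [A b]. *)
have V_lt a b : W a -> W b -> lt a b -> V a <> V b.
  move=> Wa Wb ab Vab; have [_ [p Vp] _] := VP _ Wa.
  have [k0] := K_inh.
  have [z Az /(_ k0)] := wit_mem b (fun=> a) p Wb (fun=> conj Wa ab) (fun=> Vp).
  rewrite Vab; have [_ _ /[apply]] := VP _ Wb; apply; exact: subset_closure.
have V_inj : {in W &, injective V}.
  move=> a b; rewrite !inE => Wa Wb Vab; have [ab|//|ba] := tri a b.
    by case: (V_lt _ _ Wa Wb ab).
  by case: (V_lt _ _ Wb Wa ba).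
have [||G [GF Glam [p Gp]]] := calX (V @` W).
- by move=> _ [a Wa <-]; have [] := VP _ Wa.
- apply: (card_eq_trans (inj_card_eq V_inj)).
  by rewrite card_eq_le lamW card_leT.
pose I := W `&` [set a | G (V a)].
have nIK : ~ (I #<= [set: K]).
  move=> IK; apply: K_lambda; rewrite -(card_le_eql Glam).
  apply: (card_le_trans _ IK); apply: (card_le_trans _ (card_image_le V I)).
  by apply: subset_card_le => U GU; have [a Wa aU] := GF _ GU; exists a;
    rewrite /I /= ?aU.
(* J plays the role of the first K^+ elements of I. *)
have [J [JI nJK Jseg]] := minimal_segment wf
  (fun A : set lambda => ~ (A #<= [set: K])) I
  (fun A B AB => contra_not (card_le_trans (subset_card_le AB))) nIK.
have JW a : J a -> W a by move=> /JI[].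
have Jp a : J a -> V a p by move=> /JI[_ /Gp].
have [j0 Jj0] : J !=set0.
  apply: contrapT => J0; apply: nJK; suff -> : J = set0 by exact: card_ge0.
  by rewrite -subset0 => j Jj; apply: J0; exists j.
(* Regularity of K^+: an unbounded sequence would cover [J] by K segments, each of size at most
   K. *)
have Jbound (g : K -> lambda) : (forall k, J (g k)) ->
    exists2 b, J b & forall k, lt (g k) b.
  move=> gJ; apply: contrapT => nb; apply: nJK.
  have JU : J `<=` \bigcup_(k in [set: K]) ((J `&` [set b | lt b (g k)]) `|` [set g k]).
    move=> b Jb; apply: contrapT => nU; apply: nb; exists b => // k.
    have [//|gb|bg] := tri (g k) b; exfalso; apply: nU; exists k => //.
      by right; rewrite gb.
    by left.
  apply: (card_le_trans (subset_card_le JU)).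
  apply: (card_le_bigcup Kinf (card_lexx _)) => k _.
  apply: (card_le_setU Kinf); first by apply: contrapT; exact: Jseg.
  by apply: (range_card_le (fun=> g k)) => _ ->; exists k.
pose D := \bigcup_(a in J) A a.
(* Otherwise the complements of these closed sets cover [X]; a subcover of size K involves indices
   below a single [b], and a witness in [A b] escapes it. *)
have [q Dq qV] : exists2 q, closure D q & forall a, J a -> closure (V a) q.
  apply: contrapT => nq.
  pose UU : set (set X) := [set ~` closure (V a) | a in J] `|` [set ~` closure D].
  have [||VV [VU VK Vcov]] := lindelof UU.
  - by move=> _ [[a _ <-]|->]; apply: closed_openC; exact: closed_closure.
  - rewrite -subTset => x _; apply: contrapT => nx; apply: nq; exists x.
      by apply: contrapT => nDx; apply: nx; exists (~` closure D) => //; right.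
    move=> a Ja; apply: contrapT => nVx; apply: nx; exists (~` closure (V a)) => //.
    by left; exists a.
  have [e eV] := card_le_range setT VK.
  (* Values of [e] not of the form in question get the harmless index [j0]. *)
  have /choice[g gP] : forall k, exists a, J a /\
      ((exists2 a, J a & e k = ~` closure (V a)) -> e k = ~` closure (V a)).
    move=> k; have [[a Ja ek]|nk] :=
      pselect (exists2 a, J a & e k = ~` closure (V a)); first by exists a.
    by exists j0.
  have [b Jb gb] := Jbound g (fun k => (gP k).1).
  have [z Az zV] : exists2 z, A b z & forall k, closure (V (g k)) z.
    apply: (wit_mem b g p (JW _ Jb)) => k; last exact/Jp/(gP k).1.
    by split=> //; exact/JW/(gP k).1.
  have [O VO Oz] : (\bigcup_(O in VV) O) z by rewrite Vcov.
  have [k _ ekO] := eV _ VO.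
  have [[a Ja aO]|OD] := VU _ VO.
    have ek : e k = ~` closure (V (g k)).
      by apply: (gP k).2; exists a => //; rewrite ekO aO.
    by move: Oz; rewrite -ekO ek; apply; exact: zV.
  by move: Oz; rewrite OD; apply; apply: subset_closure; exists b.
have [C CCC Cq] : (\bigcup_(C in CC) C) q by rewrite CC_cover.
(* A point [y] of [A a] is in the closure of [s (y, C)], which lies in [C] and in every later
   [A b]. *)
have DCq : closure (D `&` C) q.
  move=> N; rewrite nbhsE => -[O [Oop Oq] ON].
  have [y [[a Ja Aay] Oy]] := Dq _ (open_nbhs_nbhs (conj Oop Oq)).
  have [b Jb ab] := Jbound (fun=> a) (fun=> Ja).
  have [k0] := K_inh; have {}ab := ab k0.
  have [sC _ sy] := sP (y, C) CCC.
  have [t [st Ot]] := sy _ (open_nbhs_nbhs (conj Oop Oy)).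
  exists t; split; last exact: ON.
  split; last exact: sC.
  exists b => //; apply: (A_sub a b (JW _ Ja) ab); right.
  by exists y => //; exists C.
have [B [BDC BK Bq]] := CC_tight C _ _ CCC (@subIsetr _ D C) Cq DCq.
have [e eB] := card_le_range q BK.
have /choice[g gP] : forall k, exists a, J a /\ (D (e k) -> A a (e k)).
  move=> k; have [[a Ja Aa]|nD'] := pselect (D (e k)); first by exists a.
  by exists j0.
(* Now [B] lies in [A b], so [q] is in the closures of both [A b] and [V b]. *)
have [b Jb gb] := Jbound g (fun k => (gP k).1).
have [_ _ /(_ q (qV _ Jb))] := VP _ (JW _ Jb); apply.
apply: closureS Bq => y By; have [k _ ky] := eB _ By.
apply: (A_sub (g k) b (JW _ (gP k).1) (gb k)); left; rewrite -ky.
by apply: (gP k).2; rewrite ky; have [] := BDC _ By.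
Qed.

End caliber_density.

(** * Attainment of the cardinal invariants, and the theorem *)

Lemma infinite_nat_sum (T : Type) : infinite_card (nat + T).
Proof. by apply/infiniteP/(@inj_card_leT _ _ inl) => m n []. Qed.

Lemma card_le_nat_sum {T : Type} (A : set T) : A #<= [set: nat + T].
Proof.
by apply: (card_le_trans (card_leT A)); apply: (@inj_card_leT _ _ inr) => x y [].
Qed.

(** To rule out the dummy value of [least_card], some cardinal must qualify: [nat + Y] is infinite
    and bounds every subset of [Y]. *)
Lemma tightnessP (Y : topologicalType) :
  is_least_card (fun K => infinite_card K /\
    forall (A : set Y) (x : Y), closure A x ->
    exists B : set Y, [/\ B `<=` A, B #<= [set: K] & closure B x]) (tightness Y).
Proof.
apply: least_cardP; exists (nat + Y)%type; split; first exact: infinite_nat_sum.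
by move=> A x Ax; exists A; split=> //; exact: card_le_nat_sum.
Qed.

(** Pull [A] back to the subspace, apply its tightness, and push the small set forward along the
    continuous inclusion. *)
Lemma subspace_tightness {X : topologicalType} {K : Type} {A C : set X} {x : X} :
  [set: tightness (set_type C)] #<= [set: K] ->
  A `<=` C -> C x -> closure A x ->
  exists B, [/\ B `<=` A, B #<= [set: K] & closure B x].
Proof.
move=> tK AC Cx Ax; pose x' : C := SigSub (mem_set Cx).
have [[_ tC] _] := tightnessP C.
have [|B [BA BK Bx]] := tC (set_val @^-1` A) x'.
  move=> N [_ [[O Oop <-] Ox ON]].
  have [y [Ay Oy]] := Ax _ (open_nbhs_nbhs (conj Oop Ox)).
  by exists (SigSub (mem_set (AC _ Ay))); split=> //; exact: ON.
exists (set_val @` B); split.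
- by move=> _ [y By <-]; exact: BA.
- exact: card_le_trans (card_image_le _ _) (card_le_trans BK tK).
- move=> N Nx; have [|y [By Ny]] := Bx (set_val @^-1` N).
    exact: (@initial_continuous C X set_val).
  by exists (set_val y); split=> //; exists y.
Qed.

Lemma lindelof_degreeP (X : topologicalType) :
  is_least_card (fun K => infinite_card K /\
    forall UU : set (set X),
      (forall U, UU U -> open U) -> \bigcup_(U in UU) U = [set: X] ->
    exists VV : set (set X),
      [/\ VV `<=` UU, VV #<= [set: K] & \bigcup_(V in VV) V = [set: X]])
    (lindelof_degree X).
Proof.
apply: least_cardP; exists (nat + set X)%type.
split=> [|UU _ UX]; first exact: infinite_nat_sum.
by exists UU; split=> //; exact: card_le_nat_sum.
Qed.

Lemma weak_tightnessP (X : topologicalType) :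
  is_least_card (fun K => infinite_card K /\
    exists CC : set (set X),
      [/\ \bigcup_(C in CC) C = [set: X],
          CC #<= [set: set K] &
          forall C, CC C ->
            [set: tightness (set_type C)] #<= [set: K] /\
            mu_closure (set K) C = [set: X]])
    (weak_tightness X).
Proof.
apply: least_cardP; exists (nat + X)%type.
split; first exact: infinite_nat_sum.
(* The one-member cover works: tightness is at most [nat + X], and each point is in the closure of
   its singleton. *)
exists [set setT]; split; first by rewrite bigcup_set1.
  by apply: (range_card_le (fun=> setT)) => _ ->; exists set0.
move=> _ ->; split.
  apply: (tightnessP _).2; split=> [|A x Ax]; first exact: infinite_nat_sum.
  exists A; split=> //; apply: (card_le_trans (card_leT A)).
  rewrite (card_le_eql (card_setT _)); exact: card_le_nat_sum.
rewrite -subTset => x _; exists [set x]; last exact: subset_closure.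
by split=> //; apply: (range_card_le (fun=> x)) => _ ->; exists set0.
Qed.

Lemma card_succ_le {K L : Type} :
  ~ ([set: L] #<= [set: K]) -> [set: card_succ K] #<= [set: L].
Proof.
move=> LK; have KL : card_lt K L by split=> //; case: (card_le_total K L).
by have /least_cardP[_] : exists L, card_lt K L by [exists L]; exact.
Qed.

Lemma density_le {X : topologicalType} {K : Type} {D : set X} :
  dense D -> D #<= [set: K] -> [set: density X] #<= [set: K].
Proof.
move=> Dd DK.
have /least_cardP[_ /(_ D)dD] : exists L : Type,
    exists E : set X, dense E /\ E #= [set: L].
  by exists D, D; split=> //; exact: card_setT_sym.
rewrite -(card_le_eql (card_setT D)) in DK; apply: card_le_trans DK; apply: dD.
by exists D; split=> //; exact: card_setT_sym.
Qed.

Theorem theorem5p3 (X : topologicalType) (lambda : Type) :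
  let kappa : Type := (lindelof_degree X * weak_tightness X)%type in
  quasiregular X ->
  card_lt kappa lambda ->
  [set: lambda] #<= [set: card_succ (set kappa)] ->
  caliber X lambda ->
  [set: density X] #<= [set: set kappa].
Proof.
move=> kappa qX [_ lamK] lam_succ calX.
have [[Linf Lind] _] := lindelof_degreeP X.
have [[winf [CC [CCcov CCcard CCP]]] _] := weak_tightnessP X.
have [[l0 _] [w0 _]] := (infinite_setN0 Linf, infinite_setN0 winf).
have LK : [set: lindelof_degree X] #<= [set: kappa].
  by apply: (@inj_card_leT _ _ (fun l => (l, w0))) => x y [].
have wK : [set: weak_tightness X] #<= [set: kappa].
  by apply: (@inj_card_leT _ _ (fun w => (l0, w))) => x y [].
have Kinf : infinite_card kappa.
  by apply/infiniteP; apply: card_le_trans LK; exact/infiniteP.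
suff [D [Dd DK]] : exists D : set X, dense D /\ D #<= [set: set kappa].
  exact: density_le Dd DK.
apply: (@caliber_density X kappa lambda CC) => //.
- move=> UU Uop /(Lind _ Uop)[VV [VU VL Vcov]].
  by exists VV; split=> //; exact: card_le_trans VL LK.
- exact: card_le_trans CCcard (card_le_setT_set wK).
- by move=> C A x /CCP[tC _]; apply: subspace_tightness; exact: card_le_trans tC wK.
- move=> C /CCP[_ CX]; rewrite -subTset -CX => x [B [BC Bw] Bx].
  by exists B => //; split=> //; exact: card_le_trans Bw (card_le_setT_set wK).
- by move=> L nL; apply: (card_le_trans lam_succ); exact: card_succ_le.
Qed.
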